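(* Consider LSVRG with arbitrary sampling (defined in the context) with stepsize $\alpha=\min_j\frac{n}{4\frac{v_j}{p_j}+\frac{\sigma n}{\rho}}$. Then its iteration complexity is $\max_j\left(4\frac{v_j}{n\sigma p_j}+\frac1\rho\right)\log\frac1\epsilon$; that is, there exists $\beta>0$ such that, with $$\Psi^k=\|x^k-x^*\|^2+\alpha\beta^2\sum_{j=1}^n\left\|(\mathbf M_j^\dagger)^{1/2}\left(\nabla f_j(\phi^k)-\nabla f_j(x^* )\right)\right\|^2,$$ for every $\epsilon\in(0,1)$ and every integer $k\ge\max_j\left(4\frac{v_j}{n\sigma p_j}+\frac1\rho\right)\log\frac1\epsilon$ we have $\mathbb E[\Psi^k]\le\epsilon\,\Psi^0$.
   Context: Problem. $f_1,\dots,f_n:\mathbb R^d\to\mathbb R$ are differentiable and convex, $f=\frac1n\sum_{j=1}^n f_j$, $\psi:\mathbb R^d\to\mathbb R\cup\{+\infty\}$ is proper, closed and convex. $\min_x f(x)+\psi(x)$ has a unique minimizer $x^*$, and $f$ is $\sigma$-quasi strongly convex with $\sigma>0$: $f(x^* )\ge f(y)+\langle\nabla f(y),x^*-y\rangle+\frac\sigma2\|y-x^*\|^2$ for all $y$. Each $f_j$ is $\mathbf M_j$-smooth, $\mathbf M_j\succeq0$ symmetric: $f_j(x)\le f_j(y)+\langle\nabla f_j(y),x-y\rangle+\frac12(x-y)^\top\mathbf M_j(x-y)$ for all $x,y$. $\mathrm{prox}_{\alpha\psi}(x)=\arg\min_u\{\alpha\psi(u)+\frac12\|u-x\|^2\}$;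 $\dagger$ is the Moore–Penrose pseudoinverse. Sampling. $R$ is a random subset of $[n]$ with arbitrary distribution such that $p_j=\mathbb P(j\in R)>0$ for all $j$; $\rho\in(0,1]$. The vector $v\in\mathbb R^n$ satisfies $\mathbb E\left[\left\|\sum_{j\in R}\mathbf M_j^{1/2}h_j\right\|^2\right]\le\sum_{j=1}^n p_jv_j\|h_j\|^2$ for all $h_1,\dots,h_n\in\mathbb R^d$. Algorithm (LSVRG with arbitrary sampling). Given $x^0\in\mathbb R^d$, set $\phi^0=x^0$. For $k=0,1,2,\dots$: draw $R^k$, a copy of $R$ independent of the past; $g^k=\frac1n\sum_{j=1}^n\nabla f_j(\phi^k)+\sum_{j\in R^k}\frac1{np_j}\left(\nabla f_j(x^k)-\nabla f_j(\phi^k)\right)$; $x^{k+1}=\mathrm{prox}_{\alpha\psi}(x^k-\alpha g^k)$; independently, set $\phi^{k+1}=x^k$ with probability $\rho$ and $\phi^{k+1}=\phi^k$ with probability $1-\rho$. Standing assumption. For all $k$ and all $j$: $\nabla f_j(x^k)-\nabla f_j(x^* )=\mathbf M_j^\dagger\mathbf M_j(\nabla f_j(x^k)-\nabla f_j(x^* ))$ and $\nabla f_j(\phi^k)-\nabla f_j(x^* )=\mathbf M_j^\dagger\mathbf M_j(\nabla f_j(\phi^k)-\nabla f_j(x^* ))$. *)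

(* Defs.v *)
(* Vectors of R^d are column vectors 'cV[R]_d over a
   realType R.  The library norm on matrices is the sup norm, so the Euclidean
   inner product and squared norm are introduced here; differentiability and
   topology do not depend on this choice. *)
From HB Require Import structures.
From mathcomp Require Import all_boot all_order all_algebra.
From mathcomp Require Import all_classical all_reals all_analysis.

Set Implicit Arguments.
Unset Strict Implicit.
Unset Printing Implicit Defensive.

Import Order.TTheory GRing.Theory Num.Theory.
Import numFieldNormedType.Exports.

Local Open Scope classical_set_scope.
Local Open Scope ring_scope.

Section LinearAlgebra.
Context {R : realType} {d : nat}.
Implicit Types (u w : 'cV[R]_d) (M X : 'M[R]_d).

Definition dotv u w : R := (u^T *m w) 0 0.

Definition sqnorm u : R := dotv u u.

Definition is_psd M := M^T = M /\ forall u, 0 <= dotv u (M *m u).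

(* The positive semidefinite square root, unique for positive semidefinite M. *)
Definition mxsqrt M : 'M[R]_d :=
  xget 0 [set X : 'M[R]_d | is_psd X /\ X *m X = M].

(* The Penrose equations; they determine X uniquely. *)
Definition is_mp_inverse M X :=
  [/\ M *m X *m M = M, X *m M *m X = X,
      (M *m X)^T = M *m X & (X *m M)^T = X *m M].

(* mathcomp's [pinvmx] is only a partial inverse, not the Moore-Penrose one. *)
Definition mp_inverse M : 'M[R]_d :=
  xget 0 [set X : 'M[R]_d | is_mp_inverse M X].

End LinearAlgebra.

Section Functions.
Context {R : realType} {d : nat}.
Implicit Types (f : 'cV[R]_d -> R) (psi : 'cV[R]_d -> \bar R).

(* The vector of partial derivatives: the gradient when f is differentiable. *)
Definition grad f (x : 'cV[R]_d) : 'cV[R]_d :=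
  \col_i 'D_(delta_mx i 0 : 'cV[R]_d) f x.

Definition matrix_smooth (M : 'M[R]_d) f := forall x y : 'cV[R]_d,
  f x <= f y + dotv (grad f y) (x - y) + 2^-1 * dotv (x - y) (M *m (x - y)).

Definition quasi_strongly_convex (sigma : R) (xs : 'cV[R]_d) f :=
  forall y : 'cV[R]_d,
    f xs >= f y + dotv (grad f y) (xs - y) + sigma / 2 * sqnorm (y - xs).

Definition proper_fun psi :=
  (forall x, psi x != -oo%E) /\ (exists x, psi x != +oo%E).

Definition closed_fun psi :=
  closed [set z : 'cV[R]_d * R | (psi z.1 <= z.2%:E)%E].

Definition econvex_fun psi := forall (x y : 'cV[R]_d) (t : R), 0 < t < 1 ->
  (psi (t *: x + (1 - t) *: y)%R
     <= t%:E * psi x + (1 - t)%:E * psi y)%E.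

Definition is_minimizer (g : 'cV[R]_d -> \bar R) x := forall y, (g x <= g y)%E.

Definition is_unique_minimizer (g : 'cV[R]_d -> \bar R) x :=
  is_minimizer g x /\ forall z, is_minimizer g z -> z = x.

Definition argmin (g : 'cV[R]_d -> \bar R) : 'cV[R]_d :=
  xget 0 [set u | is_minimizer g u].

Definition prox (alpha : R) psi (x : 'cV[R]_d) : 'cV[R]_d :=
  argmin (fun u => alpha%:E * psi u + (2^-1 * sqnorm (u - x))%:E)%E.

Definition average {n : nat} (f : 'I_n -> 'cV[R]_d -> R) (x : 'cV[R]_d) : R :=
  n%:R^-1 * \sum_j f j x.

End Functions.

(* The first value is used as the default of the big operator, so that these
   are the true minimum and maximum of the finite family. *)
Definition min_fam {R : realType} {n : nat} (a : 'I_n.+1 -> R) : R :=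
  \big[Num.min/a ord0]_j a j.

Definition max_fam {R : realType} {n : nat} (a : 'I_n.+1 -> R) : R :=
  \big[Num.max/a ord0]_j a j.

Section Probability.
Context {R : realType} {dT : measure_display} {T : measurableType dT}.
Variable P : probability T R.

Definition finite_rv {U : finType} (Y : T -> U) :=
  forall y, measurable (Y @^-1` [set y]).

Definition same_law {U : finType} (Y Z : T -> U) :=
  forall y, P (Y @^-1` [set y]) = P (Z @^-1` [set y]).

(* The sigma-algebra generated by a random variable with values in a finite
   set. *)
Definition events_of {U : finType} (Y : T -> U) : set (set T) :=
  [set Y @^-1` B | B in [set: set U]].

Definition mutually_independent {I : eqType} (F : I -> set (set T)) :=
  forall (s : seq I) (A : I -> set T), uniq s ->
    (forall i, i \in s -> F i (A i)) ->
    P (\bigcap_(i in [set` s]) A i) = (\prod_(i <- s) P (A i))%E.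

(* The number p_j. *)
Definition incl_prob {n : nat} (S : T -> {set 'I_n}) (j : 'I_n) : R :=
  fine (P [set w | j \in S w]).

Definition eso {n d : nat} (S : T -> {set 'I_n}) (M : 'I_n -> 'M[R]_d)
    (v : 'I_n -> R) :=
  forall h : 'I_n -> 'cV[R]_d,
    ('E_P[fun w => sqnorm (\sum_(j in S w) mxsqrt (M j) *m h j)]
      <= (\sum_j incl_prob S j * v j * sqnorm (h j))%:E)%E.

(* [Sk k] is the set drawn at iteration k, and [Ck k] is the coin that decides
   whether the reference point is refreshed at iteration k.  Independence of
   the past, and of the coin from the set, means that all these draws are
   mutually independent; the index [inl k] stands for [Sk k] and [inr k] for
   [Ck k]. *)
Definition lsvrg_draws {n : nat} (S : T -> {set 'I_n}) (rho : R)
    (Sk : nat -> T -> {set 'I_n}) (Ck : nat -> T -> bool) :=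
  [/\ forall k, finite_rv (Sk k) /\ same_law (Sk k) S,
      forall k, finite_rv (Ck k) /\ P (Ck k @^-1` [set true]) = rho%:E &
      mutually_independent (fun i : nat + nat =>
        match i with
        | inl k => events_of (Sk k)
        | inr k => events_of (Ck k)
        end)].

End Probability.

Section LSVRG.
Context {R : realType} {d n : nat}.
Variables (f : 'I_n -> 'cV[R]_d -> R) (psi : 'cV[R]_d -> \bar R).

Definition lsvrg_estimator (p : 'I_n -> R) (x phi : 'cV[R]_d)
    (S : {set 'I_n}) : 'cV[R]_d :=
  n%:R^-1 *: \sum_j grad (f j) phi
  + \sum_(j in S) (n%:R * p j)^-1 *: (grad (f j) x - grad (f j) phi).

(* The pair (x^k, phi^k), as a function of the sequences of drawn sets and
   coins. *)
Fixpoint lsvrg (p : 'I_n -> R) (alpha : R) (x0 : 'cV[R]_d)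
    (S : nat -> {set 'I_n}) (c : nat -> bool) (k : nat) :
    'cV[R]_d * 'cV[R]_d :=
  if k is k'.+1 then
    let: (x, phi) := lsvrg p alpha x0 S c k' in
    (prox alpha psi (x - alpha *: lsvrg_estimator p x phi (S k')),
     if c k' then x else phi)
  else (x0, x0).

Definition lyapunov (M : 'I_n -> 'M[R]_d) (xs : 'cV[R]_d) (alpha beta : R)
    (z : 'cV[R]_d * 'cV[R]_d) : R :=
  sqnorm (z.1 - xs)
  + alpha * beta ^+ 2 * \sum_j sqnorm
      (mxsqrt (mp_inverse (M j)) *m (grad (f j) z.2 - grad (f j) xs)).

End LSVRG.

(* Main.v *)
(* Optimality makes xs the fixed point of x |-> prox (x - alpha grad f xs), and
   prox is nonexpansive, so |x^{k+1} - xs|^2 is at most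
   |x^k - xs - alpha (g^k - grad f xs)|^2.  In expectation the cross term is
   controlled by quasi strong convexity and cocoercivity, and the second moment
   of g^k - grad f xs by the ESO inequality, both in terms of the residuals
   sum_j |(M_j^+)^{1/2} (grad f_j y - grad f_j xs)|^2 at y = x^k and y = phi^k.
   With beta^2 = 1 / (2 n rho) the Lyapunov function then contracts by the factor
   1 - alpha sigma in one conditional step.  The draws take finitely many values,
   so this conditional step is a finite weighted sum, and an almost sure range
   assumption suffices. *)
Require Import Defs.
From mathcomp Require Import all_boot all_order all_algebra.
From mathcomp Require Import all_classical all_reals all_analysis.
From mathcomp Require Import complex ring lra.

Import Order.TTheory GRing.Theory Num.Theory.
Import numFieldNormedType.Exports.

Set Implicit Arguments.
Unset Strict Implicit.
Unset Printing Implicit Defensive.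

Local Open Scope classical_set_scope.
Local Open Scope ring_scope.

(** * Linear algebra *)

Section InnerProduct.
Context {R : realType} {d : nat}.
Implicit Types (u w x : 'cV[R]_d) (A : 'M[R]_d) (a : R).

Lemma dotvE u w : dotv u w = \sum_i u i 0 * w i 0.
Proof. by rewrite /dotv mxE; apply: eq_bigr => i _; rewrite !mxE. Qed.

Lemma dotvC u w : dotv u w = dotv w u.
Proof. by rewrite !dotvE; apply: eq_bigr => i _; rewrite mulrC. Qed.

Lemma dotvDr u w x : dotv u (w + x) = dotv u w + dotv u x.
Proof. by rewrite /dotv mulmxDr mxE. Qed.

Lemma dotvZr a u w : dotv u (a *: w) = a * dotv u w.
Proof. by rewrite /dotv -scalemxAr mxE. Qed.

Lemma dotvDl u w x : dotv (u + w) x = dotv u x + dotv w x.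
Proof. by rewrite dotvC dotvDr !(dotvC x). Qed.

Lemma dotvZl a u w : dotv (a *: u) w = a * dotv u w.
Proof. by rewrite dotvC dotvZr dotvC. Qed.

Lemma dotvNr u w : dotv u (- w) = - dotv u w.
Proof. by rewrite -scaleN1r dotvZr mulN1r. Qed.

Lemma dotvNl u w : dotv (- u) w = - dotv u w.
Proof. by rewrite dotvC dotvNr dotvC. Qed.

Definition dotv_linear := (dotvDl, dotvDr, dotvNl, dotvNr, dotvZl, dotvZr).

Lemma dotv0 u : dotv u 0 = 0.
Proof. by rewrite -(scale0r 0) dotvZr mul0r. Qed.

Lemma dotv_sumr (I : Type) (r : seq I) (Q : pred I) u (F : I -> 'cV[R]_d) :
  dotv u (\sum_(i <- r | Q i) F i) = \sum_(i <- r | Q i) dotv u (F i).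
Proof.
by elim/big_rec2: _ => [|i y1 y2 _ <-]; [exact: dotv0|exact: dotvDr].
Qed.

Lemma dotv_mulmx u w A : dotv u (A *m w) = dotv (A^T *m u) w.
Proof. by rewrite /dotv trmx_mul trmxK mulmxA. Qed.

Lemma sqnorm_ge0 u : 0 <= sqnorm u.
Proof. by rewrite /sqnorm dotvE sumr_ge0// => i _; rewrite -expr2 sqr_ge0. Qed.

Lemma sqnorm_eq0 u : (sqnorm u == 0) = (u == 0).
Proof.
apply/idP/eqP => [|->]; last by rewrite /sqnorm dotv0.
rewrite /sqnorm dotvE psumr_eq0; last by move=> i _; rewrite -expr2 sqr_ge0.
move=> /allP u0; apply/colP => i; rewrite mxE.
by have := u0 i; rewrite mem_index_enum mulf_eq0 orbb => /(_ isT)/eqP.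
Qed.

Lemma sqnorm0 : sqnorm (0 : 'cV[R]_d) = 0.
Proof. by apply/eqP; rewrite sqnorm_eq0. Qed.

Lemma sqnormN u : sqnorm (- u) = sqnorm u.
Proof. by rewrite /sqnorm dotvNl dotvNr opprK. Qed.

Lemma sqnormD u w : sqnorm (u + w) = sqnorm u + 2 * dotv u w + sqnorm w.
Proof. by rewrite /sqnorm !dotv_linear (dotvC w u); ring. Qed.

Lemma sqnormB u w : sqnorm (u - w) = sqnorm u - 2 * dotv u w + sqnorm w.
Proof. by rewrite sqnormD sqnormN dotvNr mulrN. Qed.

Lemma sqnormZ a u : sqnorm (a *: u) = a ^+ 2 * sqnorm u.
Proof. by rewrite /sqnorm !dotv_linear; ring. Qed.

Lemma sqnormB_le u w : sqnorm (u - w) <= 2 * sqnorm u + 2 * sqnorm w.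
Proof. by have := sqnorm_ge0 (u + w); rewrite sqnormD sqnormB; lra. Qed.

End InnerProduct.

(** * Real functional calculus for symmetric matrices: square roots and pseudoinverses *)

Section FunctionalCalculus.
Context {R : realType}.

(** Newton's scheme: the correction added for a new node is a multiple of the product of the
    ['X - r%:P] over the old nodes, which vanishes at these and not at the new one. *)
Lemma poly_interpolation (F : fieldType) (rs : seq F) (phi : F -> F) :
  uniq rs -> exists q : {poly F}, forall r, r \in rs -> q.[r] = phi r.
Proof.
elim: rs => [|r0 rs IH] /=; first by exists 0.
move=> /andP[r0rs /IH[q qE]].
pose w := \prod_(r <- rs) ('X - r%:P).
have w0 : w.[r0] != 0 by rewrite -[_ == _]/(root w r0) root_prod_XsubC.
exists (q + ((phi r0 - q.[r0]) / w.[r0]) *: w) => r.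
rewrite inE hornerD hornerZ => /orP[/eqP->|rrs]; first by rewrite divfK// subrKC.
have /rootP -> : root w r by rewrite root_prod_XsubC.
by rewrite mulr0 addr0 qE.
Qed.

(* The spectral theorem is only available over R[i]; a symmetric real matrix has
   real eigenvalues, and polynomials in it stay real, so that interpolation on
   [rs] gives a real functional calculus. *)
Lemma symmetric_annihilator n (M : 'M[R]_n.+1) : M^T = M ->
  exists2 rs : seq R, (forall r, r \in rs -> eigenvalue M r) &
    forall p : {poly R}, (forall r, r \in rs -> root p r) -> horner_mx M p = 0.
Proof.
move=> Msym; pose toC := real_complex R : {rmorphism R -> R[i]}.
pose MC := map_mx toC M.
have MCreal : MC \is a mxOver Num.real.
  by apply/mxOverP => i j; rewrite mxE; apply/complex_realP; exists (M i j).
have MCherm : MC \is hermsymmx.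
  apply: realsym_hermsym => //; apply/is_hermitianmxP.
  rewrite expr0 scale1r map_mx_id//.
  by rewrite /MC map_trmx Msym.
have /hermitian_normalmx/orthomx_spectralP := MCherm.
set Q := spectralmx MC; set D := spectral_diag MC => MCE.
have Qunit : Q \in unitmx by exact: spectral_unit.
have Dreal i : (complex.Re (D 0 i))%:C%C = D 0 i.
  by apply: RRe_real; have /mxOverP := hermitian_spectral_diag_real MCherm; exact.
exists [seq complex.Re (D 0 i) | i <- enum 'I_n.+1].
  (* The roots of the characteristic polynomial can be tested over R[i]. There row [i] of the
     diagonalizing matrix [Q] is a left eigenvector for [D 0 i], and it is nonzero because [Q] is
     invertible. *)
  move=> r /mapP[i _ ->]; rewrite eigenvalue_root_char -(fmorph_root toC).
  rewrite map_char_poly /= -/MC (Dreal i) -eigenvalue_root_char.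
  apply/eigenvalueP; exists (row i Q).
    rewrite -row_mul [in LHS]MCE !mulmxA mulmxV// mul1mx.
    by rewrite row_mul row_diag_mx -scalemxAl -rowE.
  apply: contraTneq Qunit => Qi0; rewrite unitmxE unitfE negbK.
  rewrite (expand_det_row _ i) big1// => j _.
  by have /rowP/(_ j) := Qi0; rewrite !mxE => ->; rewrite mul0r.
move=> p rootp.
suff : map_mx toC (horner_mx M p) = 0.
  move=> /matrixP pM0; apply/matrixP => i j; apply: (@complexI R).
  by have := pM0 i j; rewrite !mxE.
rewrite map_horner_mx -/MC MCE.
have /= -> := horner_mx_uconjC (map_poly toC p) (diag_mx D) Qunit.
rewrite horner_mx_diag.
suff -> : map_mx (horner (map_poly toC p)) D = 0.
  rewrite (_ : diag_mx 0 = 0) ?mulmx0 ?mul0mx//.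
  by apply/matrixP => i j; rewrite !mxE mul0rn.
apply/rowP => i; rewrite !mxE -Dreal horner_map /=.
by have /rootP -> := rootp _ (map_f _ (mem_enum _ i)).
Qed.

Lemma horner_mxM n (M : 'M[R]_n.+1) (p q : {poly R}) :
  horner_mx M (p * q) = horner_mx M p *m horner_mx M q.
Proof. exact: rmorphM. Qed.

Lemma horner_mx_sym n (M : 'M[R]_n.+1) (p : {poly R}) :
  M^T = M -> (horner_mx M p)^T = horner_mx M p.
Proof.
move=> Msym; elim/poly_ind: p => [|p c IH]; first by rewrite rmorph0 trmx0.
rewrite rmorphD linearD /= horner_mx_C tr_scalar_mx; congr (_ + _).
rewrite horner_mxM trmx_mul IH horner_mx_X Msym -{1}(horner_mx_X M).
by rewrite -!horner_mxM mulrC horner_mxM horner_mx_X.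
Qed.

(** Eigenvectors are row vectors here; by symmetry the transpose is a column eigenvector, at which
    the quadratic form is [r] times a positive squared norm. *)
Lemma psd_eigenvalue_ge0 n (M : 'M[R]_n) r :
  is_psd M -> eigenvalue M r -> 0 <= r.
Proof.
move=> [Msym Mpsd] /eigenvalueP[x xM x0].
have := Mpsd x^T; have -> : M *m x^T = r *: x^T.
  by rewrite -[M]Msym -trmx_mul xM linearZ.
rewrite dotvZr pmulr_lge0// lt_neqAle sqnorm_ge0 eq_sym sqnorm_eq0 andbT.
by apply: contra x0 => /eqP; rewrite -trmx0 => /trmx_inj ->.
Qed.

Lemma psd_has_sqrt n (M : 'M[R]_n) : is_psd M ->
  exists X : 'M[R]_n, is_psd X /\ X *m X = M.
Proof.
case: n M => [|n] M Mpsd.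
  by exists M; split => //; apply/matrixP => -[].
have [Msym _] := Mpsd; have [rs rsE rsA] := symmetric_annihilator Msym.
(* Fourth roots, so that the square root is itself a square, hence psd. *)
have [q qE] := poly_interpolation (fun r : R => Num.sqrt (Num.sqrt r)) (undup_uniq rs).
have XE : horner_mx M (q ^+ 4) = M.
  rewrite -[RHS]horner_mx_X; apply/eqP; rewrite -subr_eq0 -rmorphB /=; apply/eqP.
  apply: rsA => r rrs; apply/rootP; rewrite !hornerE qE ?mem_undup//.
  rewrite (exprM _ 2 2) !sqr_sqrtr ?sqrtr_ge0 ?subrr//.
  by apply: psd_eigenvalue_ge0 Mpsd _; exact: rsE.
exists (horner_mx M (q ^+ 2)); split; last first.
  by rewrite -horner_mxM -exprD XE.
split; first exact: horner_mx_sym.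
move=> u; rewrite expr2 horner_mxM -mulmxA dotv_mulmx.
by rewrite horner_mx_sym// sqnorm_ge0.
Qed.

(** The witness is [q] evaluated at [M], where [q] interpolates the reciprocal on the spectrum. With
    the convention that the inverse of 0 is 0, the identities r r^-1 r = r and r^-1 r r^-1 = r^-1
    hold at every eigenvalue; polynomials in [M] are symmetric, which gives the other two
    equations. *)
Lemma symmetric_has_mp_inverse n (M : 'M[R]_n) : M^T = M ->
  exists X : 'M[R]_n, is_mp_inverse M X.
Proof.
case: n M => [|n] M Msym.
  by exists M; split; apply/matrixP => -[].
have [rs _ rsA] := symmetric_annihilator Msym.
have [q qE] := poly_interpolation (fun r : R => r^-1) (undup_uniq rs).
have eqA p1 p2 : (forall r, r \in rs -> p1.[r] = p2.[r]) ->
    horner_mx M p1 = horner_mx M p2.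
  move=> p12; apply/eqP; rewrite -subr_eq0 -rmorphB /=; apply/eqP/rsA => r /p12.
  by rewrite rootE hornerD hornerN => ->; rewrite subrr.
have MqE : M *m horner_mx M q = horner_mx M ('X * q).
  by rewrite horner_mxM horner_mx_X.
have qME : horner_mx M q *m M = horner_mx M ('X * q).
  by rewrite mulrC horner_mxM horner_mx_X.
have MVM (r : R) : r * r^-1 * r = r.
  by have [->|r0] := eqVneq r 0; rewrite ?mulr0// mulfV// mul1r.
exists (horner_mx M q); split; last 2 first.
- by rewrite MqE horner_mx_sym.
- by rewrite qME horner_mx_sym.
- rewrite MqE -[RHS]horner_mx_X -[X in _ *m X]horner_mx_X -horner_mxM.
  by apply: eqA => r rrs; rewrite !hornerE qE ?mem_undup.
- rewrite qME -horner_mxM; apply: eqA => r rrs.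
  rewrite !hornerE qE ?mem_undup//.
  by have [->|r0] := eqVneq r 0; rewrite ?invr0 ?mulr0// mulfV// mul1r.
Qed.

(** The symmetry conditions force M X = M Y and X M = Y M, whence X = X M X = Y M X = Y M Y = Y. *)
Lemma mp_inverse_unique n (M X Y : 'M[R]_n) :
  is_mp_inverse M X -> is_mp_inverse M Y -> X = Y.
Proof.
move=> [MXM XMX MXT XMT] [MYM YMY MYT YMT].
have MXY : M *m X = M *m Y.
  rewrite -{1}MYM -(mulmxA (M *m Y)) -MXT -{1}MYT -trmx_mul.
  by rewrite mulmxA MXM MYT.
have XMY : X *m M = Y *m M.
  rewrite -{1}MYM -(mulmxA M) mulmxA -XMT -YMT -trmx_mul.
  by rewrite -mulmxA (mulmxA M) MXM YMT.
by rewrite -XMX XMY -mulmxA MXY mulmxA YMY.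
Qed.

Context {d : nat}.
Implicit Types (M : 'M[R]_d) (a : 'cV[R]_d).

Lemma mxsqrtP M : is_psd M -> is_psd (mxsqrt M) /\ mxsqrt M *m mxsqrt M = M.
Proof. by move=> /psd_has_sqrt; exact: xgetPex. Qed.

Lemma mp_inverseP M : M^T = M -> is_mp_inverse M (mp_inverse M).
Proof. by move=> /symmetric_has_mp_inverse; exact: xgetPex. Qed.

(** The transposed pseudoinverse satisfies the Penrose equations of [M^T], which is [M], so
    uniqueness applies. *)
Lemma mp_inverse_sym M : M^T = M -> (mp_inverse M)^T = mp_inverse M.
Proof.
move=> Msym; have MN := mp_inverseP Msym; apply: mp_inverse_unique MN.
move: (mp_inverse M) (mp_inverseP Msym) => N [MNM NMN MNT NMT].
split.
- by apply: trmx_inj; rewrite !trmx_mul trmxK Msym mulmxA MNM.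
- by rewrite -[X in _ *m X *m _]Msym -!trmx_mul mulmxA NMN.
- by rewrite trmx_mul trmxK Msym -{2}Msym -trmx_mul NMT.
- by rewrite trmx_mul trmxK Msym -{2}Msym -trmx_mul MNT.
Qed.

Lemma mp_inverseC M : M^T = M -> mp_inverse M *m M = M *m mp_inverse M.
Proof.
move=> Msym; have [_ _ MNT _] := mp_inverseP Msym.
by rewrite -MNT trmx_mul mp_inverse_sym// Msym.
Qed.

Lemma mp_inverse_psd M : is_psd M -> is_psd (mp_inverse M).
Proof.
move=> [Msym Mpsd]; split; first exact: mp_inverse_sym.
move=> u; have [_ NMN _ _] := mp_inverseP Msym.
by rewrite -NMN -!mulmxA dotv_mulmx mp_inverse_sym.
Qed.

Lemma sqnorm_mxsqrt M a : is_psd M -> sqnorm (mxsqrt M *m a) = dotv a (M *m a).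
Proof.
move=> /mxsqrtP[[Xsym _] XX].
by rewrite /sqnorm -[in RHS]XX -mulmxA [RHS]dotv_mulmx Xsym.
Qed.

(** The witness is h = M^{1/2} M^+ a: the range condition gives M^{1/2} h = M M^+ a = a, and the
    squared norm of h is a^T M^+ M M^+ a = a^T M^+ a. This puts gradient differences in the form
    that the ESO inequality accepts. *)
Lemma mxsqrt_preimage M a : is_psd M -> a = mp_inverse M *m M *m a ->
  exists2 h, mxsqrt M *m h = a &
    sqnorm h = sqnorm (mxsqrt (mp_inverse M) *m a).
Proof.
move=> Mpsd aE; have [Msym _] := Mpsd; have [_ XX] := mxsqrtP Mpsd.
have [_ NMN _ _] := mp_inverseP Msym.
exists (mxsqrt M *m (mp_inverse M *m a)).
  by rewrite mulmxA XX mulmxA -mp_inverseC.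
rewrite !sqnorm_mxsqrt//; last exact: mp_inverse_psd.
by rewrite -[in LHS](mp_inverse_sym Msym) -dotv_mulmx mp_inverse_sym// !mulmxA NMN.
Qed.

End FunctionalCalculus.

(** * Convex analysis *)

Section Gradient.
Context {R : realType} {d : nat}.
Implicit Types (f : 'cV[R]_d -> R) (x z u : 'cV[R]_d).

Lemma colE x : x = \sum_i x i 0 *: delta_mx i 0.
Proof.
rewrite [LHS]matrix_sum_delta; apply: eq_bigr => i _.
by rewrite big_ord1.
Qed.

Lemma derive_dotv f x u : differentiable f x -> 'D_u f x = dotv (grad f x) u.
Proof.
move=> df; rewrite deriveE// [in LHS](colE u) linear_sum dotvE.
by apply: eq_bigr => i _; rewrite linearZ /= /grad mxE deriveE// mulrC.
Qed.

(** The difference quotients in direction [u] are at least [c] for t in (0, 1), and the bound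
    survives the limit from the right. *)
Lemma le_grad f x u (c : R) : differentiable f x ->
  (forall t : R, 0 < t < 1 -> t * c <= f (x + t *: u) - f x) ->
  c <= dotv (grad f x) u.
Proof.
move=> df fc; rewrite -derive_dotv//.
have /cvg_dnbhs_at_right := @diff_derivable _ _ _ f x u df.
move/cvgr_to_ge; apply.
near=> t.
have t0 : 0 < t by near: t; exact: nbhs_right_gt.
have t1 : t < 1 by near: t; exact: nbhs_right_lt.
rewrite /= -[_ *: _]/(_ * _) mulrC ler_pdivlMr// mulrC.
by rewrite [_ + x]addrC; apply: fc; rewrite t0.
Unshelve. all: by end_near. Qed.

Lemma grad_average n (f : 'I_n -> 'cV[R]_d -> R) x :
  (forall j, differentiable (f j) x) ->
  differentiable (average f) x /\
  grad (average f) x = n%:R^-1 *: \sum_j grad (f j) x.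
Proof.
move=> df.
have sumE : average f = n%:R^-1 \*: \sum_j f j.
  by apply/funext => y; rewrite /average /= fct_sumE.
have dsum : differentiable (\sum_j f j) x by exact: differentiable_sum.
split; first by rewrite sumE; exact: differentiableZ.
apply/colP => i; rewrite !mxE summxE sumE deriveZ/=; last exact: diff_derivable.
rewrite derive_sum; last by move=> j; exact: diff_derivable.
by congr (_ * _); apply: eq_bigr => j _; rewrite mxE.
Qed.

Lemma convex_grad_le f x z : differentiable f x ->
  convex_function [set: 'cV[R]_d] f ->
  f x + dotv (grad f x) (z - x) <= f z.
Proof.
move=> df fconv.
suff : - (f z - f x) <= dotv (grad (- f) x) (z - x).
  have -> : grad (- f) x = - grad f x.
    by apply/colP => i; rewrite !mxE deriveN//; exact: diff_derivable.
  by rewrite dotvNl; lra.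
apply: le_grad; first exact: differentiableN.
move=> t /andP[t0 t1].
have := fconv (Itv01 (ltW t0) (ltW t1)) z x (in_setT _) (in_setT _).
rewrite convRE /= /unstable.onem.
have -> : conv (Itv01 (ltW t0) (ltW t1)) (z : convex_lmodType _) (x : convex_lmodType _)
    = x + t *: (z - x).
  rewrite -[LHS]/(t *: z + (1 - t) *: x) scalerBl scale1r scalerBr.
  by rewrite addrCA addrA.
rewrite -![(- f) _]/(- f _).
lra.
Qed.

(** The value of [f] at [x - e], with [e] the pseudoinverse applied to the gradient difference, is
    bounded below by convexity at [z] and above by smoothness at [x]. The quadratic term simplifies
    through M^+ M M^+ = M^+. *)
Lemma smooth_convex_cocoercive f (M : 'M[R]_d) x z :
  (forall y, differentiable f y) -> convex_function [set: 'cV[R]_d] f ->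
  is_psd M -> matrix_smooth M f ->
  2^-1 * sqnorm (mxsqrt (mp_inverse M) *m (grad f x - grad f z))
    <= f x - f z - dotv (grad f z) (x - z).
Proof.
move=> df fconv Mpsd fsm; have [Msym _] := Mpsd.
have [_ NMN _ _] := mp_inverseP Msym; have Nsym := mp_inverse_sym Msym.
rewrite sqnorm_mxsqrt; last exact: mp_inverse_psd.
set a := grad f x - grad f z; set e := mp_inverse M *m a.
have := le_trans (convex_grad_le (x - e) (df z) fconv) (fsm (x - e) x).
have -> : x - e - x = - e by rewrite addrAC subrr add0r.
have -> : x - e - z = (x - z) - e by rewrite addrAC.
have -> : dotv (- e) (M *m - e) = dotv a e.
  rewrite mulmxN dotvNl dotvNr opprK {1}/e -[in LHS]Nsym -dotv_mulmx.
  by rewrite /e !mulmxA NMN.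
have -> : dotv a e = dotv (grad f x) e - dotv (grad f z) e.
  by rewrite dotvDl dotvNl.
rewrite dotvDr !dotvNr; lra.
Qed.

End Gradient.

(** * Existence and nonexpansiveness of the proximal step *)

Section Prox.
Context {R : realType} {d : nat}.
Implicit Types (psi : 'cV[R]_d -> \bar R) (x y u g : 'cV[R]_d).

Lemma sqnorm_continuous : continuous (@sqnorm R d).
Proof.
move=> u; rewrite (_ : @sqnorm R d = fun x => \sum_i x i 0 * x i 0); last first.
  by apply/funext => x; rewrite /sqnorm dotvE.
apply: (@cvg_big R^o _ _ _ _ _ _ (nbhs u)) => [|i _]; first exact: add_continuous.
by apply: cvgM; exact: coord_continuous.
Qed.

Lemma sqnormB_continuous x : continuous (fun u : 'cV[R]_d => sqnorm (u - x)).
Proof.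
move=> u; apply: (@continuous_comp _ _ _
  (fun u : 'cV[R]_d => u - x : 'cV[R]_d) (@sqnorm R d)).
  by apply: (@cvgB R _ _ (nbhs u) _ id (cst x)); [exact: cvg_id|exact: cvg_cst].
exact: sqnorm_continuous.
Qed.

(** Heine-Borel is applied to row vectors, and the result is carried to columns by the continuous
    transposition. *)
Lemma compact_sqnorm_ball x (B : R) : compact [set u | sqnorm (u - x) <= B].
Proof.
pose K := [set v : 'rV[R]_d | sqnorm (v^T - x) <= B].
have trc : continuous (fun v : 'rV[R]_d => v^T).
  move=> v A [V Vv VA]; exists (fun i j => V j i) => [i j|w Vw].
    by have := Vv j i; rewrite mxE.
  by apply: VA => i j; rewrite mxE; exact: Vw.
have -> : [set u | sqnorm (u - x) <= B] = trmx @` K.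
  apply/seteqP; split => [u uB|_ [v vB <-]//].
  by exists u^T; rewrite /K /= trmxK.
apply: continuous_compact; first exact: continuous_subspaceT.
apply: bounded_closed_compact.
  (* Each coordinate satisfies |v_j - x_j|^2 <= B <= (B + 1)^2, hence |v_j| <= B + 1 + |x_j|. *)
  pose b := B + 1 + \sum_i `|x i 0|.
  exists b; split => [|b' bb' v vB]; first exact: num_real.
  apply: le_trans (ltW bb'); rewrite [leLHS]/Num.norm /= mx_normrE.
  have B0 : 0 <= B by exact: le_trans (sqnorm_ge0 _) vB.
  have x0 : 0 <= \sum_i `|x i 0| by rewrite sumr_ge0.
  apply/bigmax_leP; split => [|[i j] _ /=]; first by rewrite /b; lra.
  rewrite (ord1 i) -[v 0 j](subrK (x j 0)) (le_trans (ler_normD _ _))//.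
  apply: lerD; last by rewrite (bigD1 j)//= lerDl sumr_ge0.
  have : (v 0 j - x j 0) ^+ 2 <= B.
    apply: le_trans vB; rewrite /sqnorm dotvE (bigD1 j)//= !mxE -expr2 lerDl.
    by rewrite sumr_ge0// => k _; rewrite -expr2 sqr_ge0.
  rewrite -real_normK ?num_real// => vB'.
  rewrite -(@ler_pXn2r _ 2) ?nnegrE ?addr_ge0// (le_trans vB')//; nra.
have Kc : continuous (fun v : 'rV[R]_d => sqnorm (v^T - x)).
  move=> v; apply: (@continuous_comp _ _ _ (fun v : 'rV[R]_d => v^T)
    (fun u => sqnorm (u - x))); [exact: trc|exact: sqnormB_continuous].
exact: closed_comp (in1W Kc) (@closed_le _ B).
Qed.

(** Minimizing over the closed epigraph of [psi] replaces an extended-valued objective by the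
    continuous [phi]. The affine minorant of slope [g] confines the sublevel set of [phi] through
    [(x1, r1)] to a compact box, so a minimum is attained. *)
Lemma prox_minimizer psi (alpha r1 : R) x x1 g : 0 < alpha ->
  (forall u, psi u != -oo%E) -> closed_fun psi -> psi x1 = r1%:E ->
  (forall u, ((r1 + dotv g (u - x1))%:E <= psi u)%E) ->
  is_minimizer (fun u => alpha%:E * psi u + (2^-1 * sqnorm (u - x))%:E)%E
    (prox alpha psi x).
Proof.
move=> alpha0 psiNy psi_closed psi1 psi_ge; apply: xgetPex.
pose phi (z : 'cV[R]_d * R) := alpha * z.2 + 2^-1 * sqnorm (z.1 - x).
have phic : continuous phi.
  move=> z; apply: cvgD.
    by apply: cvgM; [exact: cvg_cst|exact: cvg_snd].
  apply: cvgM; first exact: cvg_cst.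
  apply: (@continuous_comp _ _ _ fst (fun u => sqnorm (u - x))); first exact: cvg_fst.
  exact: sqnormB_continuous.
pose E := [set z : 'cV[R]_d * R | (psi z.1 <= z.2%:E)%E].
pose E0 := E `&` [set z | phi z <= phi (x1, r1)].
have E01 : E0 (x1, r1) by split; rewrite /E /= ?psi1.
(* With e = u - x1 and c = x1 - x + alpha g, the sublevel condition and the minorant give |e|^2 + 2
   <e, c> <= 0; then |e + 2 c|^2 >= 0 yields |e|^2 <= 4 |c|^2. The lower end of the interval below
   comes from <g, e> >= - (|g|^2 + |e|^2) / 2. *)
pose B := 4 * sqnorm (x1 - x + alpha *: g).
pose box := [set u | sqnorm (u - x1) <= B] `*`
  `[r1 - (sqnorm g + B) / 2, phi (x1, r1) / alpha]%classic.
have E0box : E0 `<=` box.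
  move=> [u s] [/= psiu phiu].
  have su : r1 + dotv g (u - x1) <= s.
    by rewrite -lee_fin; exact: le_trans (psi_ge u) psiu.
  have uB : sqnorm (u - x1) <= B.
    have : alpha * (r1 + dotv g (u - x1)) + 2^-1 * sqnorm (u - x)
        <= alpha * r1 + 2^-1 * sqnorm (x1 - x).
      by apply: le_trans phiu; rewrite /phi lerD2r ler_pM2l.
    have -> : u - x = (u - x1) + (x1 - x) by rewrite subrKA.
    rewrite /B; move: (u - x1) (x1 - x) => e w.
    have := sqnorm_ge0 (e + 2 *: (w + alpha *: g)).
    rewrite (sqnormD e w) (sqnormD e) sqnormZ dotvZr dotvDr dotvZr (dotvC g).
    lra.
  split => //=; rewrite in_itv /=; apply/andP; split.
    have := sqnorm_ge0 (g + (u - x1)); rewrite sqnormD; lra.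
  rewrite ler_pdivlMr// mulrC (le_trans _ phiu)// /phi /= lerDl.
  by rewrite mulr_ge0// sqnorm_ge0.
have E0compact : compact E0.
  apply: subclosed_compact E0box; last first.
    by apply: compact_setX; [exact: compact_sqnorm_ball|exact: segment_compact].
  apply: closedI => //.
  exact: closed_comp (in1W phic) (@closed_le _ _).
have [|[u0 s0]] := compact_EVT_min _ E0compact (continuous_subspaceT phic).
  by exists (x1, r1).
rewrite inE => -[/= psiu0 phiu0] minphi.
exists u0 => y.
case psiy : (psi y) => [s| |]; last 2 first.
- by rewrite gt0_muley ?lte_fin// addye// leey.
- by have := psiNy y; rewrite psiy.
apply: (@le_trans _ _ (phi (u0, s0))%:E).
  by rewrite /phi EFinD leeD2r// EFinM lee_pmul2l ?lte_fin.
rewrite lee_fin -/(phi (y, s)).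
(* Points outside the sublevel set exceed [phi (x1, r1)], which is already at least the minimum. *)
have [ys|/ltW ys] := leP (phi (y, s)) (phi (x1, r1)).
  by apply: minphi; rewrite inE; split; rewrite // /E /= psiy.
exact: le_trans phiu0 ys.
Qed.

(** This is the first-order condition that (x - u) / alpha is a subgradient of [psi] at [u]. It
    comes from comparing [u] with the points of the segment towards [y] and dividing by [t]. *)
Lemma prox_subgradient psi (alpha ru ry : R) x u y : econvex_fun psi ->
  0 < alpha ->
  is_minimizer (fun z => alpha%:E * psi z + (2^-1 * sqnorm (z - x))%:E)%E u ->
  psi u = ru%:E -> psi y = ry%:E ->
  alpha * ru + dotv (x - u) (y - u) <= alpha * ry.
Proof.
move=> psi_convex alpha0 umin psiu psiy.
have key (t : R) : 0 < t < 1 ->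
    0 <= alpha * (ry - ru) - dotv (x - u) (y - u) + t * (2^-1 * sqnorm (y - u)).
  move=> t01; have /andP[t0 t1] := t01.
  have /(le_trans (umin _)) := leeD2r (2^-1 * sqnorm (t *: y + (1 - t) *: u - x))%:E
    (lee_wpmul2l (ltW alpha0 : (0 <= alpha%:E)%E) (psi_convex y u t t01)).
  rewrite psiu psiy -!EFinM -!EFinD lee_fin.
  have -> : t *: y + (1 - t) *: u - x = (u - x) + t *: (y - u).
    by apply/colP => i; rewrite !mxE; ring.
  rewrite -(opprB x u) sqnormD sqnormZ dotvZr dotvNl => H.
  have : 0 <= t * (alpha * (ry - ru) - dotv (x - u) (y - u)
    + t * (2^-1 * sqnorm (y - u))).
    by move: H; rewrite sqnormN; lra.
  by rewrite pmulr_rge0.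
suff : 0 <= alpha * (ry - ru) - dotv (x - u) (y - u) by lra.
move: key; set a := _ - _; set b := 2^-1 * _ => key.
have b0 : 0 <= b by rewrite mulr_ge0// sqnorm_ge0.
rewrite leNgt; apply/negP => a0.
have ba : 0 < 2 * (b - a) by lra.
(* If a < 0, this explicit t lies in (0, 1) and makes a + t b negative: multiplied by 2 (b - a), the
   sum becomes a (b - 2 a). *)
have := key (- a / (2 * (b - a))).
rewrite divr_gt0// ?oppr_gt0// ltr_pdivrMr// mul1r => /(_ _)/wrap[|]; first by lra.
rewrite -mulrA mulNr [_^-1 * b]mulrC mulrA -mulNr.
rewrite -(ler_pM2r ba) mul0r mulrDl divfK ?gt_eqF//.
nra.
Qed.

(** Optimality makes [- grad h u] a subgradient of [psi] at [u]: along the segment towards [y],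
    convexity of [psi] bounds the difference quotients of [h] from below. *)
Lemma minimizer_subgradient (h : 'cV[R]_d -> R) psi (ru : R) u y :
  econvex_fun psi -> (forall z, psi z != -oo%E) -> differentiable h u ->
  is_minimizer (fun z => (h z)%:E + psi z)%E u -> psi u = ru%:E ->
  ((ru - dotv (grad h u) (y - u))%:E <= psi y)%E.
Proof.
move=> psi_convex psiNy dh umin psiu.
case psiy : (psi y) => [ry| |]; last 2 first.
- by rewrite leey.
- by have := psiNy y; rewrite psiy.
rewrite lee_fin.
suff : ru - ry <= dotv (grad h u) (y - u) by lra.
apply: le_grad => // t t01; have /andP[t0 t1] := t01.
have := psi_convex y u t t01; rewrite psiu psiy => H.
have := le_trans (umin (t *: y + (1 - t) *: u)) (leeD2l _ H).
rewrite psiu -!EFinM -!EFinD lee_fin.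
have -> : t *: y + (1 - t) *: u = u + t *: (y - u).
  by apply/colP => i; rewrite !mxE; ring.
lra.
Qed.

Lemma prox_contract psi (h : 'cV[R]_d -> R) (alpha : R) xs q :
  0 < alpha -> proper_fun psi -> closed_fun psi -> econvex_fun psi ->
  differentiable h xs -> is_minimizer (fun z => (h z)%:E + psi z)%E xs ->
  sqnorm (prox alpha psi q - xs) <= sqnorm (q - (xs - alpha *: grad h xs)).
Proof.
move=> alpha0 [psiNy [z psiz]] psi_closed psi_convex dh xsmin.
have [rs psixs] : exists rs, psi xs = rs%:E.
  have := xsmin z; have := psiNy xs.
  case: (psi xs) => [rs| |//]; first by exists rs.
  by move=> _; case: (psi z) psiz (psiNy z).
have sub y := minimizer_subgradient y psi_convex psiNy dh xsmin psixs.
(* Optimality of [xs] supplies the affine minorant of slope [- grad h xs] that existence of the prox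
   requires. *)
have := @prox_minimizer psi alpha rs q xs (- grad h xs) alpha0 psiNy psi_closed psixs.
move=> /(_ _)/wrap[|umin]; first by move=> y; rewrite dotvNl.
move: (prox alpha psi q) umin => u umin.
have [ru psiu] : exists ru, psi u = ru%:E.
  have := umin xs; rewrite psixs; have := psiNy u.
  case: (psi u) => [ru| |//]; first by exists ru.
  by move=> _; rewrite gt0_muley ?lte_fin// addye// leye_eq.
have := prox_subgradient psi_convex alpha0 umin psiu psixs.
have := sub u; rewrite psiu lee_fin => H1 H2.
have {H1} : alpha * (rs - dotv (grad h xs) (u - xs)) <= alpha * ru.
  by rewrite ler_pM2l.
move: H2; rewrite -(opprB u xs) dotvNr => H2 H1.
(* [H1] and [H2] add up to nonnegativity of the inner product of these two summands, so the square
   of the second is at most that of the sum. *)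
have -> : q - (xs - alpha *: grad h xs) = (q - u + alpha *: grad h xs) + (u - xs).
  by apply/colP => i; rewrite !mxE; ring.
rewrite [leRHS]sqnormD dotvDl dotvZl.
have := sqnorm_ge0 (q - u + alpha *: grad h xs).
move: H1 H2; rewrite !mulrBr; lra.
Qed.

End Prox.

(** * Finitely valued random variables *)

Section FiniteRandomVariables.
Context {R : realType} {dT : measure_display} {T : measurableType dT}.
Variable P : probability T R.

Lemma finite_rv_preimage (U : finType) (Y : T -> U) (B : set U) :
  finite_rv Y -> measurable (Y @^-1` B).
Proof.
move=> mY; have -> : Y @^-1` B = \bigcup_(u in B) (Y @^-1` [set u]).
  by apply/seteqP; split => [w Bw|w [u Bu Yu]]; [exists (Y w)|rewrite /= Yu].
by apply: fin_bigcup_measurable => // u _; exact: mY.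
Qed.

Lemma measurable_finite_rv (U : finType) (Y : T -> U) (g : U -> R) :
  finite_rv Y -> measurable_fun [set: T] (g \o Y).
Proof.
by move=> mY _ B mB; rewrite setTI comp_preimage; exact: finite_rv_preimage.
Qed.

Lemma finite_rv_pair (U V : finType) (Y : T -> U) (Z : T -> V) :
  finite_rv Y -> finite_rv Z -> finite_rv (fun w => (Y w, Z w)).
Proof.
move=> mY mZ [u v].
have -> : (fun w => (Y w, Z w)) @^-1` [set (u, v)]
    = Y @^-1` [set u] `&` Z @^-1` [set v].
  by apply/seteqP; split => [w [<- <-]//|w /= [<- <-]].
exact: measurableI.
Qed.

(** The variable is a finite combination of indicators of the level sets of [Y], integrated term by
    term. *)
Lemma expectation_finite_rv (U : finType) (Y : T -> U) (g : U -> R) :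
  finite_rv Y ->
  'E_P[g \o Y]%E = (\sum_u fine (P (Y @^-1` [set u])) * g u)%:E.
Proof.
move=> mY; rewrite unlock.
have E w : ((g \o Y) w)%:E
    = (\sum_u (g u)%:E * (\1_(Y @^-1` [set u]) w)%:E)%E.
  rewrite (bigD1 (Y w))//= big1 ?adde0 => [|u uY]; last first.
    by rewrite indicE memNset ?mule0//= => uE; rewrite uE eqxx in uY.
  by rewrite indicE mem_set// mule1.
under eq_integral do rewrite E.
have iu u : P.-integrable [set: T] (fun w => (\1_(Y @^-1` [set u]) w)%:E).
  exact: integrable_indic.
rewrite integral_sum//; last first.
  by move=> u; apply: integrableZl => //; exact: iu.
rewrite -sumEFin; apply: eq_bigr => u _.
rewrite (integralZl measurableT (iu u)) integral_indic// setIT EFinM fineK 1?muleC//.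
exact: fin_num_measure.
Qed.

Lemma expectation_finite_rv_le (U : finType) (Y : T -> U) (g1 g2 : U -> R) :
  finite_rv Y -> (forall u, 0 <= g1 u) -> (forall u, 0 <= g2 u) ->
  {ae P, forall w, g1 (Y w) <= g2 (Y w)} -> ('E_P[g1 \o Y] <= 'E_P[g2 \o Y])%E.
Proof.
move=> mY g10 g20 g12; apply: expectation_le => //.
- exact: measurable_finite_rv.
- exact: measurable_finite_rv.
- by move=> w; exact: g10.
- by move=> w; exact: g20.
Qed.

Lemma finite_rv_total (U : finType) (Y : T -> U) : finite_rv Y ->
  \sum_u fine (P (Y @^-1` [set u])) = 1.
Proof.
move=> mY; have := expectation_finite_rv (cst 1) mY.
rewrite (_ : cst 1 \o Y = cst 1)// expectation_cst => -[->].
by apply: eq_bigr => u _; rewrite mulr1.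
Qed.

Lemma finite_rv_prob (U : finType) (Y : T -> U) (B : pred U) : finite_rv Y ->
  fine (P [set w | B (Y w)]) = \sum_(u | B u) fine (P (Y @^-1` [set u])).
Proof.
move=> mY; have := expectation_finite_rv (fun u => (B u)%:R) mY.
have -> : (fun u => (B u)%:R) \o Y = \1_[set w | B (Y w)] :> (T -> R).
  apply/funext => w /=; rewrite indicE; congr (_%:R)%R; congr nat_of_bool.
  by apply/idP/idP; rewrite inE.
rewrite unlock integral_indic// ?setIT => [->/=|].
  rewrite [RHS]big_mkcond; apply: eq_bigr => u _.
  by case: (B u); rewrite ?mulr1 ?mulr0.
exact: (finite_rv_preimage [set u | B u]).
Qed.

End FiniteRandomVariables.

(** * Geometric decay in expectation for an iteration driven by independent finite draws *)

Section RandomIteration.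
Context {R : realType} {dT : measure_display} {T : measurableType dT}.
Variable P : probability T R.
Context {U : finType} {Z : Type}.
Variables (step : Z -> U -> Z) (z0 : Z).
Implicit Types (a : nat -> U).

Fixpoint trajectory a (k : nat) : Z :=
  if k is k'.+1 then step (trajectory a k') (a k') else z0.

Lemma eq_trajectory a b k : (forall i, (i < k)%N -> a i = b i) ->
  trajectory a k = trajectory b k.
Proof.
elim: k => //= k IH ab; rewrite IH ?ab// => i ik.
by apply: ab; rewrite ltnS ltnW.
Qed.

Variables (X : nat -> T -> U) (q : U -> R).
Hypothesis X_rv : forall k, finite_rv (X k).

(* Independence and identical distribution, tested on cylinders. *)
Hypothesis X_law : forall k a,
  fine (P [set w | forall i, (i < k)%N -> X i w = a i]) = \prod_(i < k) q (a i).

(** Bundling the first [k] draws into one finitely valued variable turns expectations at time [k]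
    into finite sums. *)
Let history k w : k.-tuple U := [tuple X i w | i < k].

Let historyE k w (u0 : U) i : (i < k)%N -> nth u0 (history k w) i = X i w.
Proof. by move=> ik; rewrite -(tnth_nth _ _ (Ordinal ik)) tnth_mktuple. Qed.

Let history_preimage k (h : k.-tuple U) (u0 : U) :
  history k @^-1` [set h] = [set w | forall i, (i < k)%N -> X i w = nth u0 h i].
Proof.
apply/seteqP; split => [w <- i ik|w Xh]; first by rewrite historyE.
by apply: eq_from_tnth => i; rewrite tnth_mktuple Xh// (tnth_nth u0).
Qed.

Let history_rv k : finite_rv (history k).
Proof.
move=> h; case: k h => [|k] h.
  rewrite (_ : _ @^-1` _ = setT)//; apply/seteqP; split => // w _.
  by rewrite /= [LHS]tuple0 [RHS]tuple0.
rewrite (history_preimage h (thead h)).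
rewrite (_ : [set w | _] = \bigcap_(i in `I_k.+1) X i @^-1` [set nth (thead h) h i])//.
by apply: fin_bigcap_measurable => // i _; exact: X_rv.
Qed.

Lemma expectation_trajectoryE k (F : Z -> R) (u0 : U) :
  'E_P[fun w => F (trajectory (X ^~ w) k)]%E
  = 'E_P[(fun h : k.-tuple U => F (trajectory (nth u0 h) k)) \o history k]%E.
Proof.
congr expectation; apply/funext => w /=; congr F; apply: eq_trajectory => i ik.
by rewrite historyE.
Qed.

(** The tower property: the joint law of the history and the next draw factors into the law of the
    history times [q]. *)
Lemma expectation_trajectoryS k (F : Z -> R) :
  'E_P[fun w => F (trajectory (X ^~ w) k.+1)]%E
  = 'E_P[fun w => (\sum_u q u * F (step (trajectory (X ^~ w) k) u))%R]%E.
Proof.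
(* A probability space is nonempty; a sample point yields an element of [U] to serve as default for
   [nth]. *)
have [w0] : [set: T] !=set0.
  apply/set0P/eqP => T0; have := @probability_setT _ _ _ P.
  by rewrite T0 measure0 => -[] /esym/eqP; rewrite oner_eq0.
pose u0 := X 0 w0 => _.
rewrite (expectation_trajectoryE k (fun z => \sum_u q u * F (step z u)) u0).
rewrite expectation_finite_rv//.
pose G (hu : k.-tuple U * U) := F (step (trajectory (nth u0 hu.1) k) hu.2).
have -> : (fun w => F (trajectory (X ^~ w) k.+1))
    = G \o (fun w => (history k w, X k w)).
  apply/funext => w; rewrite /G /=; congr (F (step _ _)).
  by apply: eq_trajectory => i ik; rewrite historyE.
rewrite expectation_finite_rv; last exact: finite_rv_pair.
congr EFin.
pose law h u := fine (P ((fun w => (history k w, X k w)) @^-1` [set (h, u)])).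
rewrite (eq_bigr (fun hu => law hu.1 hu.2 * G (hu.1, hu.2))); last by case.
rewrite -(pair_bigA _ (fun h u => law h u * G (h, u)))/= {}/law.
apply: eq_bigr => h _; rewrite mulr_sumr; apply: eq_bigr => u _.
rewrite mulrA; congr (_ * _).
(* Taking [u] itself as default makes [nth u h] the tuple [h] followed by [u] at index [k], so the
   joint event is a cylinder of length [k.+1]. *)
rewrite (history_preimage h u) X_law.
have -> : (fun w => (history k w, X k w)) @^-1` [set (h, u)]
    = [set w | forall i, (i < k.+1)%N -> X i w = nth u h i].
  rewrite (_ : _ @^-1` _ = history k @^-1` [set h] `&` X k @^-1` [set u]); last first.
    by apply/seteqP; split => [w [<- <-]//|w /= [<- <-]].
  rewrite (history_preimage h u); apply/seteqP; split => [w [hw uw] i|w hw].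
    rewrite ltnS leq_eqVlt => /orP[/eqP->|]; last exact: hw.
    by rewrite nth_default ?size_tuple.
  split => [i ik|]; first by apply: hw; rewrite ltnS ltnW.
  by rewrite /= hw// nth_default ?size_tuple.
by rewrite X_law big_ord_recr /= nth_default ?size_tuple.
Qed.

Lemma trajectory_drift (F : Z -> R) (r : R) : 0 <= r -> (forall z, 0 <= F z) ->
  (forall u, 0 <= q u) ->
  {ae P, forall w k, \sum_u q u * F (step (trajectory (X ^~ w) k) u)
    <= r * F (trajectory (X ^~ w) k)} ->
  forall k, ('E_P[fun w => F (trajectory (X ^~ w) k)] <= (r ^+ k * F z0)%:E)%E.
Proof.
move=> r0 F0 q0 drift; elim => [|k IH].
  by rewrite expr0 mul1r /= expectation_cst.
rewrite expectation_trajectoryS.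
have [w0] : [set: T] !=set0.
  apply/set0P/eqP => T0; have := @probability_setT _ _ _ P.
  by rewrite T0 measure0 => -[] /esym/eqP; rewrite oner_eq0.
pose u0 := X 0 w0 => _.
rewrite (expectation_trajectoryE k (fun z => \sum_u q u * F (step z u)) u0).
have G0 (z : Z) : 0 <= \sum_u q u * F (step z u).
  by apply: sumr_ge0 => u _; exact: mulr_ge0.
(* Both sides of the drift inequality are functions of the history, so its almost sure validity
   suffices to compare expectations. *)
pose g1 (h : k.-tuple U) := \sum_u q u * F (step (trajectory (nth u0 h) k) u).
pose g2 (h : k.-tuple U) := r * F (trajectory (nth u0 h) k).
have le12 : ('E_P[g1 \o history k] <= 'E_P[g2 \o history k])%E.
  apply: expectation_finite_rv_le => // [h|h|]; first exact: G0.
    exact: mulr_ge0.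
  apply: filterS drift => w /(_ k).
  by rewrite (@eq_trajectory _ (nth u0 (history k w)))// => i ik; rewrite historyE.
apply: le_trans le12 _; move: IH; rewrite (expectation_trajectoryE k F u0).
rewrite !expectation_finite_rv// !lee_fin exprS -mulrA => IH.
apply: le_trans (ler_wpM2l r0 IH); rewrite mulr_sumr ler_sum// => h _.
by rewrite mulrCA.
Qed.

End RandomIteration.

(** * One step of LSVRG *)

Section Sampling.
Context {R : realType} {dT : measure_display} {T : measurableType dT}.
Variable P : probability T R.
Context {n d : nat}.
Variables (S : T -> {set 'I_n}) (rho : R).

Definition set_law (s : {set 'I_n}) : R := fine (P (S @^-1` [set s])).

Definition coin_law (b : bool) : R := if b then rho else 1 - rho.

Definition draw_law (u : {set 'I_n} * bool) : R := set_law u.1 * coin_law u.2.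

Lemma set_law_ge0 s : 0 <= set_law s.
Proof. by rewrite fine_ge0. Qed.

Lemma sum_draw_law (G : {set 'I_n} * bool -> R) :
  \sum_u draw_law u * G u
  = \sum_s set_law s * (rho * G (s, true) + (1 - rho) * G (s, false)).
Proof.
rewrite (eq_bigr (fun u => draw_law (u.1, u.2) * G (u.1, u.2))); last by case.
rewrite -(pair_bigA _ (fun s b => draw_law (s, b) * G (s, b)))/=.
by apply: eq_bigr => s _; rewrite big_bool /draw_law /=; ring.
Qed.

Lemma lsvrg_draws_rv (Sk : nat -> T -> {set 'I_n}) (Ck : nat -> T -> bool) k :
  lsvrg_draws P S rho Sk Ck -> finite_rv (fun w => (Sk k w, Ck k w)).
Proof. by case=> Skl Ckl _; apply: finite_rv_pair; [case: (Skl k)|case: (Ckl k)]. Qed.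

Lemma lsvrg_draws_law (Sk : nat -> T -> {set 'I_n}) (Ck : nat -> T -> bool)
    k (a : nat -> {set 'I_n} * bool) :
  lsvrg_draws P S rho Sk Ck ->
  fine (P [set w | forall i, (i < k)%N -> (Sk i w, Ck i w) = a i])
  = \prod_(i < k) draw_law (a i).
Proof.
move=> [Skl Ckl indep].
pose E (i : nat + nat) := match i with
  | inl i => Sk i @^-1` [set (a i).1] | inr i => Ck i @^-1` [set (a i).2] end.
(* The event on the first [k] pairs is split into its set events and its coin events, indexed as in
   [lsvrg_draws], so that mutual independence gives the product. *)
pose r := [seq inl i : nat + nat | i <- iota 0 k] ++ [seq inr i | i <- iota 0 k].
have -> : [set w | forall i, (i < k)%N -> (Sk i w, Ck i w) = a i]
    = \bigcap_(i in [set` r]) E i.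
  apply/seteqP; split => w /= Ew.
    move=> i; rewrite /= mem_cat => /orP[] /mapP[j]; rewrite mem_iota add0n /=.
      by move=> jk ->; rewrite /E /= -Ew.
    by move=> jk ->; rewrite /E /= -Ew.
  move=> i ik; rewrite [RHS]surjective_pairing; congr pair.
    by apply: (Ew (inl i)); rewrite /= mem_cat map_f// mem_iota.
  by apply: (Ew (inr i)); rewrite /= mem_cat orbC map_f// mem_iota.
have P_Sk i s : P (Sk i @^-1` [set s]) = (set_law s)%:E.
  have [mSk SkS] := Skl i.
  by rewrite /set_law fineK -SkS//; apply: fin_num_measure; exact: mSk.
have P_Ck i b : P (Ck i @^-1` [set b]) = (coin_law b)%:E.
  have [mCk Ck1] := Ckl i; case: b => //.
  rewrite (_ : _ @^-1` _ = ~` (Ck i @^-1` [set true])); last first.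
    by apply/seteqP; split => w /=; case: (Ck i w).
  by rewrite probability_setC// Ck1.
rewrite indep; first last.
- move=> i; rewrite mem_cat => /orP[] /mapP[j _ ->] /=.
    by exists [set (a j).1].
  by exists [set (a j).2].
- rewrite cat_uniq !map_inj_uniq ?iota_uniq//= ?andbT; try by move=> ? ? [].
  by apply/hasPn => _ /mapP[i _ ->]; apply/mapP => -[].
have iotaE : iota 0 k = index_iota 0 k by rewrite /index_iota subn0.
rewrite big_cat !big_map /= iotaE !big_mkord.
rewrite (eq_bigr (fun i : 'I_k => (set_law (a i).1)%:E)) => [|i _]; last exact: P_Sk.
rewrite [X in (_ * X)%E](eq_bigr (fun i : 'I_k => (coin_law (a i).2)%:E)) => [|i _];
  last exact: P_Ck.
by rewrite !prodEFin -EFinM -big_split.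
Qed.

Hypothesis S_rv : finite_rv S.

Lemma sum_set_law : \sum_s set_law s = 1.
Proof. exact: finite_rv_total. Qed.

Lemma incl_probE j : incl_prob P S j = \sum_(s : {set 'I_n} | j \in s) set_law s.
Proof. exact: (finite_rv_prob P (fun s : {set 'I_n} => j \in s)). Qed.

Lemma eso_sum (M : 'I_n -> 'M[R]_d) (v : 'I_n -> R) (h : 'I_n -> 'cV[R]_d) :
  eso P S M v ->
  \sum_s set_law s * sqnorm (\sum_(j in s) mxsqrt (M j) *m h j)
    <= \sum_j incl_prob P S j * v j * sqnorm (h j).
Proof.
move=> /(_ h); rewrite -lee_fin.
have := expectation_finite_rv P
  (fun s : {set 'I_n} => sqnorm (\sum_(j in s) mxsqrt (M j) *m h j)) S_rv.
by move=> <-.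
Qed.

(** The ESO inequality is tested on a family whose only nonzero member is the all-ones vector at
    index [j]; its left side is nonnegative. *)
Lemma eso_ge0 (M : 'I_n -> 'M[R]_d) (v : 'I_n -> R) j :
  eso P S M v -> (0 < d)%N -> 0 < incl_prob P S j -> 0 <= v j.
Proof.
move=> Meso d0 pj0.
pose e : 'cV[R]_d := const_mx 1.
have e0 : 0 < sqnorm e.
  rewrite lt_neqAle sqnorm_ge0 eq_sym sqnorm_eq0 andbT.
  by apply/eqP => /colP/(_ (Ordinal d0))/eqP; rewrite !mxE oner_eq0.
have := eso_sum (fun i => if i == j then e else 0) Meso.
rewrite [leRHS](bigD1 j)//= eqxx [X in _ <= _ + X]big1 ?addr0; last first.
  by move=> i /negbTE ->; rewrite sqnorm0 mulr0.
move/(le_trans (sumr_ge0 _ _)) => /(_ _)/wrap[|].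
  by move=> s _; rewrite mulr_ge0 ?set_law_ge0 ?sqnorm_ge0.
by rewrite pmulr_lge0// pmulr_rge0.
Qed.

End Sampling.

(** * Moments of the gradient estimator and the one-step contraction *)

Section Drift.
Context {R : realType} {dT : measure_display} {T : measurableType dT}.
Variable P : probability T R.
Context {n d : nat}.
Variables (S : T -> {set 'I_n}) (M : 'I_n -> 'M[R]_d) (v : 'I_n -> R) (kappa : R).
Hypothesis n_gt0 : (0 < n)%N.
Hypothesis S_rv : finite_rv S.
Hypothesis M_psd : forall j, is_psd (M j).
Hypothesis v_eso : eso P S M v.
Hypothesis p_gt0 : forall j, 0 < incl_prob P S j.
Local Notation p := (incl_prob P S).
Local Notation q := (set_law P S).
Hypothesis kappa_ge : forall j, v j / (n%:R ^+ 2 * p j) <= kappa.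
Implicit Types a b : 'I_n -> 'cV[R]_d.

Definition weighted_sum a (s : {set 'I_n}) := \sum_(j in s) (n%:R * p j)^-1 *: a j.

Definition residual a := \sum_j sqnorm (mxsqrt (mp_inverse (M j)) *m a j).

Let n_neq0 : n%:R != 0 :> R. Proof. by rewrite pnatr_eq0 -lt0n. Qed.

Lemma set_law_average_le (E F G : {set 'I_n} -> R) (c0 c1 c2 : R) :
  (forall s, E s <= c0 + c1 * F s + c2 * G s) ->
  \sum_s q s * E s
    <= c0 + c1 * (\sum_s q s * F s) + c2 * (\sum_s q s * G s).
Proof.
move=> EFG; apply: (@le_trans _ _ (\sum_s q s * (c0 + c1 * F s + c2 * G s))).
  by apply: ler_sum => s _; rewrite ler_wpM2l ?set_law_ge0.
rewrite (eq_bigr (fun s => q s * c0 + c1 * (q s * F s) + c2 * (q s * G s))).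
  by rewrite !big_split -mulr_suml -!mulr_sumr sum_set_law// mul1r.
by move=> s _; ring.
Qed.

(** After exchanging the sums, the sets containing [j] have total mass [p j], which cancels the
    weight and leaves 1 / n. *)
Lemma weighted_sum_mean a (w : 'cV[R]_d) :
  \sum_s q s * dotv w (weighted_sum a s) = dotv w (n%:R^-1 *: \sum_j a j).
Proof.
under eq_bigr do rewrite dotv_sumr big_mkcond mulr_sumr.
rewrite exchange_big dotvZr dotv_sumr mulr_sumr; apply: eq_bigr => j _ /=.
rewrite (eq_bigr (fun s : {set 'I_n} =>
  (if j \in s then q s else 0) * dotv w ((n%:R * p j)^-1 *: a j))); last first.
  by move=> s _; case: ifP; rewrite ?mulr0 ?mul0r.
rewrite -mulr_suml -big_mkcond -incl_probE// dotvZr mulrA; congr (_ * _).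
by rewrite invfM mulrCA mulfV ?mulr1// gt_eqF.
Qed.

(** Writing a_j = M_j^{1/2} h_j, the ESO inequality for h_j / (n p_j) has coefficients p_j v_j / (n
    p_j)^2 = v_j / (n^2 p_j), each at most [kappa]. *)
Lemma weighted_sum_sqnorm a :
  (forall j, a j = mp_inverse (M j) *m M j *m a j) ->
  \sum_s q s * sqnorm (weighted_sum a s) <= kappa * residual a.
Proof.
move=> aE.
have /choice[h hP] : forall j, exists h, mxsqrt (M j) *m h = a j /\
    sqnorm h = sqnorm (mxsqrt (mp_inverse (M j)) *m a j).
  by move=> j; have [h ? ?] := mxsqrt_preimage (M_psd j) (aE j); exists h.
have := eso_sum S_rv (fun j => (n%:R * p j)^-1 *: h j) v_eso.
under eq_bigr do under eq_bigr do rewrite -scalemxAr (hP _).1.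
move/le_trans; apply; rewrite /residual mulr_sumr ler_sum// => j _.
rewrite sqnormZ (hP j).2 mulrA ler_wpM2r ?sqnorm_ge0//.
apply: le_trans (kappa_ge j); rewrite le_eqVlt; apply/orP; left; apply/eqP.
by have := p_gt0 j => pj; field; rewrite n_neq0 gt_eqF.
Qed.

(** The square of the difference is split at the cost of a factor 2; the [b] part is centered, and a
    variance is at most the second moment. *)
Lemma estimator_second_moment a b :
  (forall j, a j = mp_inverse (M j) *m M j *m a j) ->
  (forall j, b j = mp_inverse (M j) *m M j *m b j) ->
  \sum_s q s * sqnorm (weighted_sum a s
      - (weighted_sum b s - n%:R^-1 *: \sum_j b j))
    <= 2 * kappa * (residual a + residual b).
Proof.
move=> aE bE; set bbar := _ *: _.
have var : \sum_s q s * sqnorm (weighted_sum b s - bbar)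
    <= \sum_s q s * sqnorm (weighted_sum b s).
  rewrite (eq_bigr (fun s => q s * sqnorm (weighted_sum b s)
    - 2 * (q s * dotv bbar (weighted_sum b s)) + q s * sqnorm bbar)); last first.
    by move=> s _; rewrite sqnormB dotvC; ring.
  rewrite big_split sumrB -mulr_sumr -mulr_suml weighted_sum_mean sum_set_law//=.
  by have := sqnorm_ge0 bbar; rewrite /sqnorm -/bbar; lra.
apply: (@le_trans _ _ (2 * (\sum_s q s * sqnorm (weighted_sum a s))
    + 2 * \sum_s q s * sqnorm (weighted_sum b s - bbar))).
  rewrite !mulr_sumr -big_split; apply: ler_sum => s _ /=.
  rewrite ![2 * (_ * _)]mulrCA -mulrDr ler_wpM2l ?set_law_ge0//.
  exact: sqnormB_le.
by have := weighted_sum_sqnorm aE; have := weighted_sum_sqnorm bE; lra.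
Qed.

Variables (f : 'I_n -> 'cV[R]_d -> R) (psi : 'cV[R]_d -> \bar R).
Variables (xs : 'cV[R]_d) (sigma rho alpha beta : R).
Hypothesis f_differentiable : forall j x, differentiable (f j) x.
Hypothesis f_convex : forall j, convex_function [set: 'cV[R]_d] (f j).
Hypothesis psi_proper : proper_fun psi.
Hypothesis psi_closed : closed_fun psi.
Hypothesis psi_convex : econvex_fun psi.
Hypothesis xs_min : is_minimizer (fun x => (average f x)%:E + psi x)%E xs.
Hypothesis f_qsc : quasi_strongly_convex sigma xs (average f).
Hypothesis f_smooth : forall j, matrix_smooth (M j) (f j).
Hypothesis sigma_gt0 : 0 < sigma.
Hypothesis alpha_gt0 : 0 < alpha.
Hypothesis rho_gt0 : 0 < rho.
Hypothesis kappa_alpha : alpha * (4 * n%:R * kappa + sigma / rho) = 1.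
Hypothesis betaE : beta ^+ 2 = (2 * n%:R * rho)^-1.

Local Notation gap x := (fun j => grad (f j) x - grad (f j) xs).

Lemma average_gap x : n%:R^-1 *: \sum_j (gap x) j
  = grad (average f) x - grad (average f) xs.
Proof.
have gradE y : grad (average f) y = n%:R^-1 *: \sum_j grad (f j) y.
  by have [] := @grad_average _ _ _ f y (fun j => f_differentiable j y).
by rewrite !gradE sumrB scalerBr.
Qed.

(** Quasi strong convexity at [x] is added to the averaged cocoercivity bound on the Bregman
    distance from [xs]; the function values cancel. *)
Lemma gap_coercive x :
  (2 * n%:R)^-1 * residual (gap x) + sigma / 2 * sqnorm (x - xs)
    <= dotv (x - xs) (n%:R^-1 *: \sum_j (gap x) j).
Proof.
rewrite average_gap.
have bregman : (2 * n%:R)^-1 * residual (gap x)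
    <= average f x - average f xs - dotv (grad (average f) xs) (x - xs).
  have [_ ->] := @grad_average _ _ _ f xs (fun j => f_differentiable j xs).
  have dotv_suml w : dotv (\sum_j grad (f j) xs) w = \sum_j dotv (grad (f j) xs) w.
    by rewrite dotvC dotv_sumr; apply: eq_bigr => j _; exact: dotvC.
  rewrite dotvZl dotv_suml /average -!mulrBr invfM [2^-1 * _]mulrC -mulrA.
  rewrite ler_wpM2l ?invr_ge0 ?ler0n// /residual mulr_sumr -!sumrB.
  apply: ler_sum => j _.
  by apply: smooth_convex_cocoercive => // y; exact: f_differentiable.
have := f_qsc x; rewrite -(opprB x xs) dotvNr dotvDr dotvNr.
rewrite (dotvC _ (grad (average f) x)) (dotvC _ (grad (average f) xs)).
lra.
Qed.

(* The choice of [beta] and [kappa] cancels the coefficient of [Rb] and leaves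
   a nonnegative slack in front of [Ra]. *)
Lemma drift_arithmetic (D Ra Rb cross second : R) : 0 <= Ra ->
  (2 * n%:R)^-1 * Ra + sigma / 2 * D <= cross ->
  second <= 2 * kappa * (Ra + Rb) ->
  D + alpha * beta ^+ 2 * (rho * Ra + (1 - rho) * Rb)
    + - (2 * alpha) * cross + alpha ^+ 2 * second
  <= (1 - alpha * sigma) * (D + alpha * beta ^+ 2 * Rb).
Proof.
move=> Ra0 hcross hsecond.
have n0 : 0 < n%:R :> R by rewrite ltr0n.
apply: (@le_trans _ _ (D + alpha * beta ^+ 2 * (rho * Ra + (1 - rho) * Rb)
  - (2 * alpha) * ((2 * n%:R)^-1 * Ra + sigma / 2 * D)
  + alpha ^+ 2 * (2 * kappa * (Ra + Rb)))).
  have := ler_wpM2l (ltW alpha_gt0) hcross.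
  have := ler_wpM2l (sqr_ge0 alpha) hsecond.
  by lra.
have alpha_neq0 : alpha != 0 by rewrite gt_eqF.
(* Solving the stepsize relation for [kappa] reduces the claim to a rational identity with an
   explicit nonnegative remainder. *)
have kappaE : kappa = (alpha^-1 - sigma / rho) / (4 * n%:R).
  have a1 : alpha^-1 = 4 * n%:R * kappa + sigma / rho.
    by apply: (mulfI alpha_neq0); rewrite kappa_alpha mulfV.
  by rewrite a1 addrK mulrC mulKf// mulf_neq0 ?n_neq0 ?pnatr_eq0.
rewrite betaE kappaE -subr_ge0.
have rho_neq0 : rho != 0 by rewrite gt_eqF.
have -> : (1 - alpha * sigma) * (D + alpha * (2 * n%:R * rho)^-1 * Rb)
    - (D + alpha * (2 * n%:R * rho)^-1 * (rho * Ra + (1 - rho) * Rb)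
       - 2 * alpha * ((2 * n%:R)^-1 * Ra + sigma / 2 * D)
       + alpha ^+ 2 * (2 * ((alpha^-1 - sigma / rho) / (4 * n%:R)) * (Ra + Rb)))
    = alpha / (2 * n%:R) * (alpha * sigma / rho) * Ra.
  by field; rewrite rho_neq0 n_neq0.
by rewrite !mulr_ge0 ?invr_ge0 ?mulr_ge0 ?(ltW sigma_gt0) ?(ltW alpha_gt0)
  ?(ltW rho_gt0) ?(ltW n0).
Qed.

Definition lsvrg_step (z : 'cV[R]_d * 'cV[R]_d) (u : {set 'I_n} * bool) :=
  (prox alpha psi (z.1 - alpha *: lsvrg_estimator f p z.1 z.2 u.1),
   if u.2 then z.1 else z.2).

Lemma lsvrg_trajectory x0 (Sk : nat -> {set 'I_n}) (Ck : nat -> bool) k :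
  lsvrg f psi p alpha x0 Sk Ck k
  = trajectory lsvrg_step (x0, x0) (fun i => (Sk i, Ck i)) k.
Proof. by elim: k => //= k ->; case: trajectory. Qed.

Lemma lsvrg_drift z :
  (forall j, (gap z.1) j = mp_inverse (M j) *m M j *m (gap z.1) j) ->
  (forall j, (gap z.2) j = mp_inverse (M j) *m M j *m (gap z.2) j) ->
  \sum_u draw_law P S rho u * lyapunov f M xs alpha beta (lsvrg_step z u)
    <= (1 - alpha * sigma) * lyapunov f M xs alpha beta z.
Proof.
case: z => x phi /= xE phiE.
rewrite sum_draw_law /lyapunov /=.
(* This is the deviation of the estimator from the gradient at [xs], expressed by gaps so that the
   moment lemmas apply. *)
pose noise s := weighted_sum (gap x) s
  - (weighted_sum (gap phi) s - n%:R^-1 *: \sum_j (gap phi) j).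
have noiseE s : lsvrg_estimator f p x phi s - grad (average f) xs = noise s.
  have WE : \sum_(j in s) (n%:R * p j)^-1 *: (grad (f j) x - grad (f j) phi)
      = weighted_sum (gap x) s - weighted_sum (gap phi) s.
    rewrite /weighted_sum -sumrB; apply: eq_bigr => j _.
    by rewrite -scalerBr; congr (_ *: _); apply/colP => i; rewrite !mxE; ring.
  have [_ gradphiE] := @grad_average _ _ _ f phi (fun j => f_differentiable j phi).
  rewrite /noise average_gap /lsvrg_estimator WE -gradphiE.
  move: (weighted_sum (gap x) s) (weighted_sum (gap phi) s) => a b.
  by apply/colP => i; rewrite !mxE; ring.
have proxle s : sqnorm (prox alpha psi (x - alpha *: lsvrg_estimator f p x phi s) - xs)
    <= sqnorm (x - xs) - 2 * alpha * dotv (x - xs) (noise s)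
       + alpha ^+ 2 * sqnorm (noise s).
  have [df _] := @grad_average _ _ _ f xs (fun j => f_differentiable j xs).
  apply: (le_trans (prox_contract _ alpha_gt0 psi_proper psi_closed psi_convex
    df xs_min)).
  have -> : x - alpha *: lsvrg_estimator f p x phi s
      - (xs - alpha *: grad (average f) xs)
      = (x - xs) - alpha *: noise s.
    by rewrite -noiseE; apply/colP => i; rewrite !mxE; ring.
  by rewrite (sqnormB (x - xs)) dotvZr sqnormZ; lra.
(* The two [phi] terms cancel in the mean: the estimator is unbiased. *)
have meannoise : \sum_s q s * dotv (x - xs) (noise s)
    = dotv (x - xs) (n%:R^-1 *: \sum_j (gap x) j).
  rewrite (eq_bigr (fun s => q s * dotv (x - xs) (weighted_sum (gap x) s)
    - (q s * dotv (x - xs) (weighted_sum (gap phi) s)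
       - q s * dotv (x - xs) (n%:R^-1 *: \sum_j (gap phi) j)))); last first.
    by move=> s _; rewrite /noise !dotvDr !dotvNr !dotvDr !dotvNr; ring.
  by rewrite 2!sumrB -mulr_suml sum_set_law// !weighted_sum_mean mul1r subrr subr0.
set Ra := \sum_j sqnorm (_ *m (grad (f j) x - _)).
set Rb := \sum_j sqnorm (_ *m (grad (f j) phi - _)).
have := estimator_second_moment xE phiE.
have := gap_coercive x.
rewrite -meannoise -[residual (gap x)]/Ra -[residual (gap phi)]/Rb.
rewrite -/(noise _).
set D := sqnorm (x - xs); set cross := \sum_s q s * dotv _ _.
set second := \sum_s q s * sqnorm _.
move=> coercive moment.
have Ra0 : 0 <= Ra by apply: sumr_ge0 => j _; exact: sqnorm_ge0.
pose K := D + alpha * beta ^+ 2 * (rho * Ra + (1 - rho) * Rb).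
apply: (@le_trans _ _ (K + - (2 * alpha) * cross + alpha ^+ 2 * second)).
  by apply: set_law_average_le => s; have := proxle s; rewrite -/D /K; lra.
exact: drift_arithmetic coercive moment.
Qed.

End Drift.

(** * Complexity *)

(** Dividing each fraction by n shows [alpha] to be the minimum of the [(den j)^-1], so its inverse
    is the largest [den j], attained because the family is finite. *)
Lemma stepsize_inv {R : realType} {m : nat} (w : 'I_m.+1 -> R) (sigma rho alpha : R) :
  0 < sigma -> 0 < rho -> (forall j, 0 <= w j) ->
  alpha = min_fam (fun j => m.+1%:R / (4 * w j + sigma * m.+1%:R / rho)) ->
  [/\ 0 < alpha, forall j, 4 * w j / m.+1%:R + sigma / rho <= alpha^-1 &
      exists j, alpha^-1 = 4 * w j / m.+1%:R + sigma / rho].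
Proof.
move=> sigma0 rho0 w0 alphaE.
have n0 : 0 < m.+1%:R :> R by rewrite ltr0n.
pose den j := 4 * w j / m.+1%:R + sigma / rho.
have den0 j : 0 < den j.
  by rewrite ltr_wpDl ?divr_gt0// divr_ge0 ?mulr_ge0 ?w0 ?ler0n.
have {}alphaE : alpha = min_fam (fun j => (den j)^-1).
  rewrite alphaE; congr min_fam; apply/funext => j.
  have -> : 4 * w j + sigma * m.+1%:R / rho = m.+1%:R * den j.
    by rewrite /den; field; rewrite !gt_eqF.
  by rewrite invfM mulrA mulfV ?mul1r// gt_eqF.
have alpha0 : 0 < alpha.
  by rewrite alphaE lt_bigmin ?invr_gt0// => j _; rewrite invr_gt0.
have alpha_le j : den j <= alpha^-1.
  by rewrite -[den j]invrK lef_pV2 ?posrE ?invr_gt0// alphaE bigmin_le.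
split => //.
have [j alpha_ge] : exists j, (den j)^-1 <= alpha.
  (* The default of the big minimum is its value at [ord0], so that case also yields an index. *)
  have := lexx alpha; rewrite {1}alphaE => /bigmin_leP[|[j _]] ?; first by exists ord0.
  by exists j.
exists j; apply/eqP; rewrite eq_le -/(den j) alpha_le andbT.
by rewrite -[den j]invrK lef_pV2 ?posrE ?invr_gt0.
Qed.

(** From 1 - r <= exp(-r) the power is at most exp(-r k), and the hypotheses give r k >= ln(1 /
    eps). *)
Lemma geometric_rate_le {R : realType} (r eps K : R) (k : nat) :
  0 < r <= 1 -> 0 < eps < 1 -> r^-1 <= K -> K * ln (1 / eps) <= k%:R ->
  (1 - r) ^+ k <= eps.
Proof.
move=> /andP[r0 r1] /andP[eps0 eps1] rK Kk.
have ln0 : 0 <= ln (1 / eps) by rewrite ln_ge0// ler_pdivlMr// mul1r ltW.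
have rk : ln (1 / eps) <= r * k%:R.
  by rewrite -ler_pdivrMl// (le_trans _ Kk)// ler_wpM2r.
apply: (@le_trans _ _ (expR (- r) ^+ k)).
  by rewrite lerXn2r ?nnegrE ?subr_ge0 ?expR_ge0//; exact: expR_ge1Dx.
rewrite -expRM_natl -[leRHS]lnK ?posrE// ler_expR.
by move: rk; rewrite div1r lnV ?posrE// -mulr_natl; lra.
Qed.

Theorem corollaryJ1 (R : realType) (d m : nat)
  (f : 'I_m.+1 -> 'cV[R]_d -> R) (psi : 'cV[R]_d -> \bar R)
  (M : 'I_m.+1 -> 'M[R]_d) (xs : 'cV[R]_d) (sigma : R)
  (f_differentiable : forall j x, differentiable (f j) x)
  (f_convex : forall j, convex_function [set: 'cV[R]_d] (f j))
  (psi_proper : proper_fun psi)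
  (psi_closed : closed_fun psi)
  (psi_convex : econvex_fun psi)
  (xs_minimizer :
    is_unique_minimizer (fun x => (average f x)%:E + psi x)%E xs)
  (sigma_gt0 : 0 < sigma)
  (f_qsc : quasi_strongly_convex sigma xs (average f))
  (M_psd : forall j, is_psd (M j))
  (f_smooth : forall j, matrix_smooth (M j) (f j))
  (dT : measure_display) (T : measurableType dT) (P : probability T R)
  (S : T -> {set 'I_m.+1}) (rho : R) (v : 'I_m.+1 -> R)
  (S_rv : finite_rv S)
  (p_gt0 : forall j, 0 < incl_prob P S j)
  (rho_bounds : 0 < rho <= 1)
  (v_eso : eso P S M v)
  (Sk : nat -> T -> {set 'I_m.+1}) (Ck : nat -> T -> bool)
  (draws : lsvrg_draws P S rho Sk Ck)
  (x0 : 'cV[R]_d) (alpha : R)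
  (alphaE : alpha = min_fam (fun j =>
    m.+1%:R / (4 * (v j / incl_prob P S j) + sigma * m.+1%:R / rho))) :
  let p := incl_prob P S in
  let iterate (k : nat) (w : T) :=
    lsvrg f psi p alpha x0 (fun i => Sk i w) (fun i => Ck i w) k in
  {ae P, forall w, forall (k : nat) (j : 'I_m.+1),
      let gx := grad (f j) (iterate k w).1 - grad (f j) xs in
      let gphi := grad (f j) (iterate k w).2 - grad (f j) xs in
      gx = mp_inverse (M j) *m M j *m gx /\
      gphi = mp_inverse (M j) *m M j *m gphi} ->
  exists beta : R, 0 < beta /\
    forall (eps : R) (k : nat), 0 < eps < 1 ->
      max_fam (fun j => 4 * (v j / (m.+1%:R * sigma * p j)) + rho^-1)
        * ln (1 / eps) <= k%:R ->
      ('E_P[fun w => lyapunov f M xs alpha beta (iterate k w)]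
        <= (eps * lyapunov f M xs alpha beta (x0, x0))%:E)%E.
Proof.
move=> p iterate in_range; have /andP[rho0 rho1] := rho_bounds.
have n0 : 0 < m.+1%:R :> R by rewrite ltr0n.
pose beta := Num.sqrt (2 * m.+1%:R * rho)^-1.
have betaE : beta ^+ 2 = (2 * m.+1%:R * rho)^-1.
  by rewrite sqr_sqrtr// invr_ge0 !mulr_ge0// ltW.
exists beta; split; first by rewrite sqrtr_gt0 invr_gt0 !mulr_gt0.
move=> eps k eps01 kK; have /andP[eps0 _] := eps01.
have [d0|d0] := posnP d.
  (* In dimension 0 the weights [v] may be negative, but every vector vanishes. *)
  have lyap0 z : lyapunov f M xs alpha beta z = 0.
    have sqnorm_dim0 (u : 'cV[R]_d) : sqnorm u = 0.
      by rewrite /sqnorm dotvE big1// => i; have := ltn_ord i; rewrite {2}d0.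
    by rewrite /lyapunov sqnorm_dim0 big1 ?mulr0 ?addr0.
  rewrite lyap0 mulr0 (_ : (fun w => _) = cst 0); last exact/funext.
  by rewrite expectation_cst.
have v0 j : 0 <= v j by exact: eso_ge0 v_eso d0 (p_gt0 j).
have w0 j : 0 <= v j / p j by rewrite divr_ge0// ltW.
have [alpha0 alpha_le [j0 alpha_eq]] := stepsize_inv sigma_gt0 rho0 w0 alphaE.
(* Chosen so that [alpha * (4 n kappa + sigma / rho) = 1]; minimality of [alpha]
   then makes [kappa] dominate every v_j / (n^2 p_j). *)
pose kappa := (alpha^-1 - sigma / rho) / (4 * m.+1%:R).
have kappa_alpha : alpha * (4 * m.+1%:R * kappa + sigma / rho) = 1.
  by rewrite /kappa; field; rewrite !gt_eqF.
have kappa_ge j : v j / (m.+1%:R ^+ 2 * p j) <= kappa.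
  rewrite /kappa ler_pdivlMr ?mulr_gt0// lerBrDr; apply: le_trans (alpha_le j).
  rewrite lerD2r le_eqVlt; apply/orP; left; apply/eqP.
  by have := p_gt0 j; rewrite -/p => pj; field; rewrite !gt_eqF.
(* The upper bound follows from alpha^-1 >= sigma / rho >= sigma, as rho <= 1. *)
have rate : 0 < alpha * sigma <= 1.
  rewrite mulr_gt0//= mulrC -ler_pdivlMr// div1r.
  apply: le_trans (alpha_le j0); apply: ler_wpDl.
    by rewrite divr_ge0 ?ler0n// mulr_ge0 ?w0.
  by rewrite ler_pdivlMr// ler_piMr// ltW.
(* At the index [j0] attaining the stepsize, (alpha sigma)^-1 is exactly a member of the family. *)
have rate_le : (alpha * sigma)^-1
    <= max_fam (fun j => 4 * (v j / (m.+1%:R * sigma * p j)) + rho^-1).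
  apply: le_trans (le_bigmax _ _ j0); rewrite invfM alpha_eq.
  rewrite le_eqVlt; apply/orP; left; apply/eqP.
  by have := p_gt0 j0; rewrite -/p => pj; field; rewrite !gt_eqF.
pose step := lsvrg_step P S f psi alpha.
have iterateE i w : iterate i w
    = trajectory step (x0, x0) (fun k => (Sk k w, Ck k w)) i.
  exact: lsvrg_trajectory.
have lyap_ge0 z : 0 <= lyapunov f M xs alpha beta z.
  apply: addr_ge0; first exact: sqnorm_ge0.
  apply: mulr_ge0; first by rewrite mulr_ge0 ?sqr_ge0 ?ltW.
  by apply: sumr_ge0 => j _; exact: sqnorm_ge0.
have law_ge0 u : 0 <= draw_law P S rho u.
  rewrite mulr_ge0 ?set_law_ge0// /coin_law.
  by case: u.2; rewrite ?subr_ge0 ?(ltW rho0).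
under [X in expectation _ X]funext do rewrite iterateE.
have drift := @trajectory_drift _ _ _ P _ _ step (x0, x0)
  (fun k w => (Sk k w, Ck k w)) (draw_law P S rho)
  (fun k => lsvrg_draws_rv k draws) (fun k a => lsvrg_draws_law k a draws)
  (lyapunov f M xs alpha beta) (1 - alpha * sigma).
apply: le_trans (drift _ lyap_ge0 law_ge0 _ k) _.
- by case/andP: rate; rewrite subr_ge0.
- apply: filterS in_range => w range i.
  have := range i; rewrite iterateE => {}range.
  apply: (lsvrg_drift (v := v) (kappa := kappa)) => //.
  + by case: xs_minimizer.
  + by move=> j; case: (range j).
  + by move=> j; case: (range j).
rewrite lee_fin ler_wpM2r//.
exact: geometric_rate_le rate eps01 rate_le kK.
Qed.
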